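(* Let $f\in\mathbb{R}[x,y]_{2d}$ be a nonnegative binary form and let $F\subseteq\mathrm{Gram}(f)$ be a (nonempty) face of rank $r$. Then $\dim(F)\leq\binom{r-1}{2}$.
   Context: $\mathbb{R}[x,y]_m$ denotes the space of real binary forms of degree $m$ (together with $0$). A form $f\in\mathbb{R}[x,y]_{2d}$ is nonnegative if $f(a,b)\ge 0$ for all $(a,b)\in\mathbb{R}^2$. Let $V=\mathbb{R}[x,y]_d$, let $\mathsf{S}_2V\subseteq V\otimes V$ be the space of symmetric tensors (invariant under $p\otimes q\mapsto q\otimes p$) and let $\mu:\mathsf{S}_2V\to\mathbb{R}[x,y]_{2d}$ be the linear map induced by $p\otimes q\mapsto pq$. Every $\theta\in\mathsf{S}_2V$ can be written as $\theta=\sum_{i=1}^r\epsilon_i\,p_i\otimes p_i$ with $\epsilon_i=\pm1$ and $p_1,\dots,p_r\in V$ linearly independent; then $\mathrm{im}(\theta)=\mathrm{span}(p_1,\dots,p_r)$, $\mathrm{rk}(\theta)=r$, and $\theta$ is positive semidefinite (psd) if all $\epsilon_i=1$. The (symmetric) Gram spectrahedron is $\mathrm{Gram}(f)=\{\theta\in\mathsf{S}_2V:\theta\text{ psd},\ \mu(\theta)=f\}$. For a nonempty face $F$ of $\mathrm{Gram}(f)$ put $\mathscr{U}(F)=\sum_{\theta\in F}\mathrm{im}(\theta)\subseteq V$; the rank of $F$ is $\mathrm{rk}(F)=\dim\mathscr{U}(F)$ (this equals $\mathrm{rk}(\theta)$ for every $\theta$ in the relative interior of $F$). *)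

(* Defs.v *)
From HB Require Import structures.
From mathcomp Require Import all_boot all_order all_algebra.
From mathcomp Require Import boolp classical_sets reals convex.
From mathcomp Require Import mpoly.

Set Implicit Arguments.
Unset Strict Implicit.
Unset Printing Implicit Defensive.

Import Order.TTheory GRing.Theory Num.Theory.
Local Open Scope classical_set_scope.
Local Open Scope ring_scope.

(* The least subspace containing an arbitrary subset of a finite-dimensional
   space; [vspanP] shows that the default value 0 is never used. *)
Definition vspan (K : fieldType) (V : vectType K) (A : set V) : {vspace V} :=
  xget 0%VS [set U : {vspace V} | (A `<=` [set` U]) /\
    forall W : {vspace V}, A `<=` [set` W] -> (U <= W)%VS].

Lemma vspanP (K : fieldType) (V : vectType K) (A : set V) :
  (A `<=` [set` vspan A]) /\
  forall W : {vspace V}, A `<=` [set` W] -> (vspan A <= W)%VS.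
Proof.
rewrite /vspan; case: xgetP => [U _ //|nU]; exfalso.
pose P n := `[< exists s : seq V, (forall v, v \in s -> A v) /\ \dim <<s>> = n >].
have exP : exists n, P n.
  by exists (\dim <<[::] : seq V>>); apply/asboolP; exists [::].
have bP n : P n -> (n <= \dim {:V})%N.
  by move=> /asboolP[s [_ <-]]; apply/dimvS/subvf.
case: (ex_maxnP exP bP) => m /asboolP[s [sA dims]] maxm.
apply: (nU <<s>>%VS); split=> [v Av /=|W AW]; last first.
  by apply/span_subvP => v /sA /AW.
have sub : (<<s>> <= <<v :: s>>)%VS.
  by apply: sub_span => w ws; rewrite inE ws orbT.
have : (\dim <<v :: s>> <= \dim <<s>>)%N.
  rewrite dims; apply: maxm; apply/asboolP; exists (v :: s); split=> // w.
  by rewrite inE => /orP[/eqP->//|/sA].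
rewrite (geq_leqif (dimv_leqif_sup sub)) => vs.
by apply: (subvP vs); apply: memv_span; rewrite inE eqxx.
Qed.

(* The dimension of the affine hull of A. *)
Definition affine_dim (K : fieldType) (V : vectType K) (A : set V) : nat :=
  \dim (vspan [set x - y | x in A & y in A]).

Definition is_face (R : realType) (E : lmodType R) (F C : set E) : Prop :=
  [/\ F `<=` C, @convex_set R E F &
      forall (x y : E) (t : R), C x -> C y -> 0 < t -> t < 1 ->
        F (t *: x + (1 - t) *: y) -> F x /\ F y].

(* V (x) V, for V of finite dimension, as the space of linear maps V^* -> V;
   p (x) q is the map l |-> l(p) q.  [tens_indE] and [tens_ind_uniq] give the
   universal property of the tensor product. *)
Definition tensor2 (K : fieldType) (V : vectType K) : vectType K :=
  'Hom('Hom(V, K^o), V).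

Definition tens (K : fieldType) (V : vectType K) (p q : V) : tensor2 V :=
  linfun (fun l : 'Hom(V, K^o) => (l p : K) *: q).

(* The i-th vector of a basis of V and the i-th vector of its dual basis. *)
Definition tbasis (K : fieldType) (V : vectType K) (i : 'I_(\dim {:V})) : V :=
  (vbasis {:V})`_i.
Definition tdual (K : fieldType) (V : vectType K) (i : 'I_(\dim {:V})) :
  'Hom(V, K^o) := linfun (coord (vbasis {:V}) i : V -> K^o).

(* The linear map on V (x) V sending p (x) q to B p q, for B bilinear. *)
Definition tens_ind (K : fieldType) (V : vectType K) (W : lmodType K)
    (B : V -> V -> W) (theta : tensor2 V) : W :=
  \sum_i B (tbasis i) (fun_of_lfun theta (tdual i)).

Lemma tensE (K : fieldType) (V : vectType K) (p q : V) (l : 'Hom(V, K^o)) :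
  fun_of_lfun (tens p q) l = (l p : K) *: q.
Proof.
have lin : linear (fun l : 'Hom(V, K^o) => (l p : K) *: q).
  by move=> a l1 l2; rewrite !lfunE /= scale_lfunE scalerDl scalerA.
pose f := GRing.isLinear.Build _ _ _ _ _ lin.
pose F : {linear 'Hom(V, K^o) -> V} := HB.pack (fun l : 'Hom(V, K^o) => (l p : K) *: q) f.
exact: (lfunE F).
Qed.

Lemma tens_linear_l (K : fieldType) (V : vectType K) (q : V) :
  linear (fun p : V => tens p q).
Proof.
move=> a p p'; apply/lfunP => l; rewrite add_lfunE scale_lfunE !tensE.
by rewrite linearD linearZ /= scalerDl scalerA.
Qed.

Lemma tens_linear_r (K : fieldType) (V : vectType K) (p : V) :
  linear (tens p).
Proof.
move=> a q q'; apply/lfunP => l; rewrite add_lfunE scale_lfunE !tensE.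
by rewrite scalerDr !scalerA mulrC.
Qed.

Lemma tens_ind_linear (K : fieldType) (V : vectType K) (W : lmodType K)
    (B : V -> V -> W) :
  (forall p, linear (B p)) -> linear (tens_ind B).
Proof.
move=> Br a s t; rewrite /tens_ind scaler_sumr -big_split /=.
by apply: eq_bigr => i _; rewrite add_lfunE scale_lfunE Br.
Qed.

Lemma vbasis_sum (K : fieldType) (V : vectType K) (p : V) :
  p = \sum_i (fun_of_lfun (tdual i) p : K) *: tbasis i.
Proof.
rewrite {1}(coord_vbasis (memvf p)); apply: eq_bigr => i _.
by rewrite /tdual lfunE.
Qed.

Lemma tens_indE (K : fieldType) (V : vectType K) (W : lmodType K)
    (B : V -> V -> W) (p q : V) :
  (forall q, linear (B^~ q)) -> (forall p, linear (B p)) ->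
  tens_ind B (tens p q) = B p q.
Proof.
move=> Bl Br; rewrite {2}(vbasis_sum p) /tens_ind.
pose fq : {linear V -> W} := HB.pack (B^~ q) (GRing.isLinear.Build _ _ _ _ _ (Bl q)).
rewrite [RHS](_ : _ = fq (\sum_i (fun_of_lfun (tdual i) p : K) *: tbasis i)) //.
rewrite linear_sum; apply: eq_bigr => i _; rewrite linearZ /= tensE.
pose fp : {linear V -> W} :=
  HB.pack (B (tbasis i)) (GRing.isLinear.Build _ _ _ _ _ (Br (tbasis i))).
by rewrite -[LHS]/(fp _) linearZ.
Qed.

Lemma tensor2_sum (K : fieldType) (V : vectType K) (theta : tensor2 V) :
  theta = \sum_i tens (tbasis i) (fun_of_lfun theta (tdual i)).
Proof.
apply/lfunP => l; rewrite sum_lfunE.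
under eq_bigr do rewrite tensE.
have lE : l = \sum_i (fun_of_lfun l (tbasis i) : K) *: tdual i.
  apply/lfunP => p; rewrite sum_lfunE {1}(vbasis_sum p) linear_sum.
  by apply: eq_bigr => i _; rewrite linearZ scale_lfunE /GRing.scale/= mulrC.
by rewrite {1}lE linear_sum; apply: eq_bigr => i _; rewrite linearZ.
Qed.

Lemma tens_ind_uniq (K : fieldType) (V : vectType K) (W : lmodType K)
    (B : V -> V -> W) (g : tensor2 V -> W) :
  linear g -> (forall p q, g (tens p q) = B p q) -> g =1 tens_ind B.
Proof.
move=> gl gB theta.
pose G : {linear tensor2 V -> W} := HB.pack g (GRing.isLinear.Build _ _ _ _ _ gl).
rewrite {1}(tensor2_sum theta) -[LHS]/(G _) linear_sum.
by apply: eq_bigr => i _; apply: gB.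
Qed.

Definition tswap (K : fieldType) (V : vectType K) : tensor2 V -> tensor2 V :=
  tens_ind (fun p q => tens q p).

Definition symmetric_tensor (K : fieldType) (V : vectType K)
    (theta : tensor2 V) : Prop :=
  tswap theta = theta.

Definition psd_tensor (K : fieldType) (V : vectType K)
    (theta : tensor2 V) : Prop :=
  exists (r : nat) (p : r.-tuple V),
    free p /\ theta = \sum_(i < r) tens (tnth p i) (tnth p i).

Definition im_tensor (K : fieldType) (V : vectType K) (theta : tensor2 V) :
    {vspace V} :=
  limg theta.

Lemma im_tensorE (K : fieldType) (V : vectType K) (r : nat) (p : r.-tuple V)
    (eps : 'I_r -> K) :
  free p -> (forall i, eps i != 0) ->
  im_tensor (\sum_(i < r) eps i *: tens (tnth p i) (tnth p i)) = <<p>>%VS.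
Proof.
move=> fp eps0; apply/eqP; rewrite eqEsubv; apply/andP; split.
  apply/subvP => v /memv_imgP[l _ ->]; rewrite sum_lfunE.
  apply: memv_suml => i _; rewrite scale_lfunE tensE.
  by apply/memvZ/memvZ/memv_span/mem_tnth.
apply/span_subvP => v /tnthP[i ->]; apply/memv_imgP.
pose l : 'Hom(V, K^o) := (eps i)^-1 *: linfun (coord p i : V -> K^o).
have lE j : (l (tnth p j) : K) = (eps i)^-1 * (j == i)%:R.
  by rewrite /l scale_lfunE lfunE /= (tnth_nth 0) coord_free // eq_sym.
exists l; first exact: memvf.
rewrite sum_lfunE (bigD1 i) //= big1 => [|j ji].
  by rewrite addr0 scale_lfunE tensE lE eqxx mulr1 scalerA divff ?scale1r.
by rewrite scale_lfunE tensE lE (negPf ji) mulr0 scale0r scaler0.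
Qed.

Definition binform (R : realType) (d : nat) : vectType R := dhomog 2 R d.

Definition nonneg_form (R : realType) (f : {mpoly R[2]}) : Prop :=
  forall v : 'I_2 -> R, 0 <= f.@[v].

Definition mu (R : realType) (d : nat) : tensor2 (binform R d) -> {mpoly R[2]} :=
  tens_ind (fun p q : dhomog 2 R d => (p : {mpoly R[2]}) * (q : {mpoly R[2]})).

Lemma mu_tens (R : realType) (d : nat) (p q : dhomog 2 R d) :
  mu (tens (p : binform R d) q) = (p : {mpoly R[2]}) * (q : {mpoly R[2]}).
Proof.
apply: tens_indE => [u|u] a s t /=; first by rewrite mulrDl scalerAl.
by rewrite mulrDr scalerAr.
Qed.

Definition Gram (R : realType) (d : nat) (f : {mpoly R[2]}) :
    set (tensor2 (binform R d)) :=
  [set theta | [/\ symmetric_tensor theta, psd_tensor theta & mu theta = f]].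
Arguments Gram {R} d f.

(* The sum of the subspaces im(theta), theta in F. *)
Definition face_space (K : fieldType) (V : vectType K) (F : set (tensor2 V)) :
    {vspace V} :=
  vspan (\bigcup_(theta in F) [set` im_tensor theta]).

Definition face_rank (K : fieldType) (V : vectType K) (F : set (tensor2 V)) :
    nat :=
  \dim (face_space F).

(* Main.v *)
(** Let U be the sum of the images of the tensors in F, of dimension r.
    Differences of elements of F are symmetric tensors in U (x) U killed by mu.
    Dehomogenizing, choose a basis b_1, ..., b_r of U with strictly decreasing
    degrees.  The 2r - 1 products b_i b_i and b_i b_(i+1) then have pairwise
    distinct degrees, so a symmetric tensor killed by mu is determined by its
    coordinates at the pairs (i, j) with i + 1 < j, of which there are
    'C(r - 1, 2). *)
Require Import Defs.
From HB Require Import structures.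
From mathcomp Require Import all_boot all_order all_algebra zify.
From mathcomp Require Import boolp classical_sets reals convex.
From mathcomp Require Import mpoly.

Set Implicit Arguments.
Unset Strict Implicit.
Unset Printing Implicit Defensive.

Import Order.TTheory GRing.Theory Num.Theory.
Local Open Scope classical_set_scope.
Local Open Scope ring_scope.

(** * Spans, bases of decreasing degree, and products of basis elements *)

(** A subspace of maximal dimension inside [P] absorbs every [a] in [A], since adjoining [a] stays
    inside [P]; by minimality of the span it then contains [vspan A]. *)
Lemma vspan_ind (K : fieldType) (V : vectType K) (A P : set V) :
  P 0 -> (forall a u v, P u -> P v -> P (a *: u + v)) -> A `<=` P ->
  [set` vspan A] `<=` P.
Proof.
move=> P0 Plin AP.
pose dimP n := `[< exists2 W : {vspace V}, [set` W] `<=` P & \dim W = n >].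
have ex_dimP : exists n, dimP n.
  exists 0%N; apply/asboolP; exists 0%VS; last exact: dimv0.
  by move=> v /=; rewrite memv0 => /eqP->.
have le_dimP n : dimP n -> (n <= \dim {:V})%N.
  by move=> /asboolP[W _ <-]; apply/dimvS/subvf.
case: (ex_maxnP ex_dimP le_dimP) => m /asboolP[W WP dimW] maxm.
suff AW : A `<=` [set` W] by move=> v /(subvP ((vspanP A).2 W AW)) /WP.
move=> a Aa /=.
have : (\dim (W + <[a]>) <= \dim W)%N.
  rewrite dimW; apply: maxm; apply/asboolP; exists (W + <[a]>)%VS => //.
  move=> _ /memv_addP[w Ww [_ /vlineP[c ->] ->]].
  by rewrite addrC; apply: Plin; [apply: AP | apply: WP].
rewrite (geq_leqif (dimv_leqif_sup (addvSl W <[a]>))) subv_add.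
by rewrite -memvE => /andP[].
Qed.

(** Gaussian elimination from the top degree, by induction on a bound for the sizes. Injectivity of
    [phi] makes the space zero once the bound is 0. *)
Lemma echelon_basis (K : fieldType) (V : vectType K)
    (phi : {linear V -> {poly K}}) (U : {vspace V}) :
  injective phi ->
  exists2 b : seq V, basis_of U b & sorted gtn [seq size (phi v) | v <- b].
Proof.
move=> phi_inj.
suff gen n (W : {vspace V}) : (forall w, w \in W -> (size (phi w) <= n)%N) ->
    exists2 b, basis_of W b & sorted gtn [seq size (phi v) | v <- b].
  apply: (gen (\max_(i < \dim U) size (phi (vbasis U)`_i)%R)%N) => u /coord_vbasis ->.
  rewrite linear_sum; apply: (leq_trans (size_sum _ _ _)).
  apply/bigmax_leqP => i _; rewrite linearZ; apply: (leq_trans (size_scale_leq _ _)).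
  exact: (leq_bigmax (F := fun i : 'I_(\dim U) => size (phi (vbasis U)`_i))).
elim: n W => [|n IHn] W le_n.
  exists [::] => //; suff -> : W = 0%VS by apply: nil_basis.
  apply/eqP; rewrite -subv0; apply/subvP => w /le_n.
  by rewrite leqn0 size_poly_eq0 memv0 -(inj_eq phi_inj) linear0.
(* The coefficient of the highest possible degree is a linear form; its kernel in [W] satisfies the
   smaller bound, and at most one basis vector lies outside it. *)
pose g := linfun (coefp n \o phi : V -> K^o).
have gE v : g v = (phi v)`_n by rewrite lfunE.
have [b basis_b sorted_b] : exists2 b, basis_of (W :&: lker g)%VS b
    & sorted gtn [seq size (phi v) | v <- b].
  apply: IHn => w; rewrite memv_cap memv_ker gE => /andP[/le_n le_w /eqP w0].
  apply/leq_sizeP => j; rewrite leq_eqVlt => /predU1P[<- //|lt_nj].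
  exact: (leq_sizeP _ _ le_w).
have [Wg|/subvPn[u Wu]] := boolP (W <= lker g)%VS.
  by exists b; rewrite // -(capv_idPl Wg).
rewrite memv_ker gE => u_n.
have size_u : size (phi u) = n.+1.
  apply/eqP; rewrite eqn_leq le_n //= ltnNge; apply: contra u_n => le_u.
  by rewrite nth_default.
exists (u :: b); last first.
  rewrite /= path_min_sorted // size_u; apply/allP => _ /mapP[v bv ->] /=.
  have : v \in (W :&: lker g)%VS by rewrite -(span_basis basis_b) memv_span.
  rewrite memv_cap memv_ker gE => /andP[/le_n le_v /eqP v0].
  rewrite ltnS; apply/leq_sizeP => j.
  rewrite leq_eqVlt => /predU1P[<- //|lt_nj].
  exact: (leq_sizeP _ _ le_v).
rewrite /basis_of free_cons (span_basis basis_b) (basis_free basis_b) andbT.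
rewrite memv_cap memv_ker gE negb_and u_n orbT andbT.
rewrite span_cons (span_basis basis_b) eqEsubv subv_add -memvE Wu capvSl /=.
apply/subvP => w Ww.
(* Subtracting [c *: u] from [w] clears the top coefficient. *)
pose c := (phi w)`_n / (phi u)`_n.
rewrite -[w](subrK (c *: u)) addrC memv_add ?memvZ ?memv_line //.
rewrite memv_cap rpredB ?rpredZ //= memv_ker gE linearB linearZ coefB coefZ.
by rewrite divfK // subrr.
Qed.

(* Among the pairs (k, l) with |k - l| <= 1, the sum k + l determines the pair
   up to order, and a smaller sum means a product of larger degree; so a nonzero
   M i j with i + j minimal cannot cancel in the top coefficient. *)
Lemma band_sum_eq0 (K : numDomainType) (r : nat) (q : 'I_r -> {poly K})
    (M : 'I_r -> 'I_r -> K) :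
  (forall i, q i != 0) ->
  (forall i j : 'I_r, (i < j)%N -> (size (q j) < size (q i))%N) ->
  (forall i j, M i j = M j i) ->
  (forall i j : 'I_r, (i.+1 < j)%N -> M i j = 0) ->
  \sum_i \sum_j M i j *: (q i * q j) = 0 -> forall i j, M i j = 0.
Proof.
move=> q0 q_dec Msym Mband sum0.
move=> i0 j0; apply/eqP/negP => /negP M0.
have [i [j [Mij min_ij]]] : exists i j : 'I_r, M i j != 0 /\
    forall k l : 'I_r, M k l != 0 -> (i + j <= k + l)%N.
  case: (arg_minnP (P := fun p : 'I_r * 'I_r => M p.1 p.2 != 0) (i0 := (i0, j0))
    (fun p => p.1 + p.2)%N M0) => -[i j] /= Mij min_ij.
  by exists i, j; split=> // k l; apply: (min_ij (k, l)).
have near k l : M k l != 0 -> (k <= l.+1)%N && (l <= k.+1)%N.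
  move=> Mkl; rewrite (leqNgt k) (leqNgt l) -negb_or; apply: contra Mkl.
  by case/orP=> /Mband; [rewrite Msym|] => ->.
have q_le (k l : 'I_r) : (k <= l)%N -> (size (q l) <= size (q k))%N.
  by rewrite leq_eqVlt => /predU1P[/val_inj->|/q_dec/ltnW].
pose n := (size (q i * q j)).-1.
have sizeM k l : size (q k * q l) = (size (q k) + size (q l)).-1.
  exact: size_mul.
(* In degree [n] only the pairs [(i, j)] and [(j, i)] contribute, and they contribute equally. *)
pose top (p : 'I_r * 'I_r) := (p == (i, j)) || (p == (j, i)).
have coefE p : M p.1 p.2 * (q p.1 * q p.2)`_n
             = M i j * lead_coef (q i * q j) *+ top p.
  case: p => k l; rewrite /top /=.
  have [|ne_ij] := eqVneq (k, l) (i, j); first by case=> -> ->.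
  have [|ne_ji] := eqVneq (k, l) (j, i).
    by case=> -> ->; rewrite Msym [q j * _]mulrC.
  have [->|Mkl] := eqVneq (M k l) 0; first by rewrite mul0r.
  rewrite nth_default ?mulr0 //=.
  have le_sum := min_ij k l Mkl.
  have := near _ _ Mij; have := near _ _ Mkl.
  have {}ne_ij : ~~ ((k == i :> nat) && (l == j :> nat)) by [].
  have {}ne_ji : ~~ ((k == j :> nat) && (l == i :> nat)) by [].
  have lt_mul (a b : 'I_r) : (a <= k)%N -> (b <= l)%N -> (a + b < k + l)%N ->
      (size (q k) + size (q l) < size (q a) + size (q b))%N.
    move=> ak bl; have := q_le _ _ ak; have := q_le _ _ bl.
    by have := @q_dec a k; have := @q_dec b l; lia.
  rewrite /n !sizeM => near_kl near_ij.
  (* Positive sizes keep the truncated predecessors in [sizeM] and [n] exact. *)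
  have sz a : (0 < size (q a))%N by rewrite size_poly_gt0.
  (* Two pairs near the diagonal with equal sums agree up to order, so the sum is strictly larger
     here; up to a swap, both indices are then at least those of the minimal pair. *)
  have /orP[/and3P[ik jl lt]|/and3P[jk il lt]] :
    [|| [&& i <= k, j <= l & i + j < k + l] | [&& j <= k, i <= l & j + i < k + l]]%N.
  - by clear - near_kl near_ij le_sum ne_ij ne_ji;
      case: (ltngtP k i) => ?; case: (ltngtP l j) => ?; case: (ltngtP k j) => ?;
      case: (ltngtP l i) => ? /=; lia.
  - have := lt_mul _ _ ik jl lt; have := sz i; have := sz j; lia.
  - by have := lt_mul _ _ jk il lt; have := sz i; have := sz j; lia.
have : \sum_p M p.1 p.2 * (q p.1 * q p.2)`_n = 0.
  transitivity (\sum_i \sum_j M i j * (q i * q j)`_n); first by rewrite pair_bigA.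
  rewrite -[RHS](coef0 K n) -[in RHS]sum0 coef_sum; apply: eq_bigr => k _.
  by rewrite coef_sum; apply: eq_bigr => l _; rewrite coefZ.
under eq_bigr do rewrite coefE.
(* The total multiplicity is at least 1, as [(i, j)] itself is counted, so in characteristic zero
   the sum cannot vanish. *)
rewrite sumrMnr (bigD1 (i, j)) //= /top eqxx /= => /eqP.
rewrite mulrn_eq0 mulf_eq0 (negPf Mij) lead_coef_eq0 mulf_eq0.
by rewrite (negPf (q0 i)) (negPf (q0 j)).
Qed.

(** Count by the second index: [j] allows [j.-1] first indices, where truncation gives the correct
    value 0 at [j = 0]. *)
Lemma card_gap_pairs (r : nat) :
  #|[set p : 'I_r * 'I_r | (p.1.+1 < p.2)%N]%SET| = 'C(r - 1, 2).
Proof.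
rewrite -sum1dep_card.
rewrite -(pair_big_dep xpredT (fun i j : 'I_r => (i.+1 < j)%N) (fun _ _ => 1%N)) /=.
rewrite (exchange_big_dep xpredT) //= subn1 -bin2_sum.
transitivity (\sum_(j < r) j.-1).
  apply: eq_bigr => j _; have le_r : (j.-1 <= r)%N by have := ltn_ord j; lia.
  transitivity (\sum_(0 <= i < j.-1) 1)%N; last by rewrite sum_nat_const_nat subn0 muln1.
  by rewrite (big_nat_widen _ _ _ _ _ le_r) big_mkord; apply: eq_bigl => i /=; lia.
by case: r => [|r]; rewrite ?big_ord0 ?big_nil // big_ord_recl big_mkord.
Qed.

(** * Symmetric tensors in coordinates *)

(** Seen as a map from the dual of [V] to [V], a symmetric tensor is self-adjoint: expand one side
    along [tbasis] and the other through [tswap]. *)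
Lemma symmetric_tensorP (K : fieldType) (V : vectType K) (theta : tensor2 V) :
  symmetric_tensor theta ->
  forall l m : 'Hom(V, K^o), l (fun_of_lfun theta m) = m (fun_of_lfun theta l).
Proof.
move=> sym l m; rewrite -[in RHS]sym /tswap /tens_ind {1}(tensor2_sum theta).
rewrite !sum_lfunE !linear_sum; apply: eq_bigr => i _ /=.
by rewrite !tensE !linearZ /= /GRing.scale /= mulrC.
Qed.

Lemma symmetric_tensor_coord (K : fieldType) (V : vectType K) (n : nat)
    (b : n.-tuple V) (theta : tensor2 V) :
  symmetric_tensor theta -> (forall l, fun_of_lfun theta l \in <<b>>%VS) ->
  theta = \sum_i \sum_j
    (coord b j (fun_of_lfun theta (linfun (coord b i : V -> K^o)))
       *: tens b`_i b`_j).
Proof.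
move=> sym im_b; pose bd i : 'Hom(V, K^o) := linfun (coord b i : V -> K^o).
have bdE i v : bd i v = coord b i v by rewrite lfunE.
apply/lfunP => l; rewrite exchange_big sum_lfunE /= {1}(coord_span (im_b l)).
(* Self-adjointness turns the [j]-th coordinate of the image of [l] into [l] applied to the image of
   [bd j], which again lies in the span of [b]. *)
apply: eq_bigr => j _; rewrite sum_lfunE -bdE (symmetric_tensorP sym).
rewrite {1}(coord_span (im_b (bd j))) linear_sum scaler_suml.
apply: eq_bigr => i _; rewrite scale_lfunE tensE linearZ scalerA -/(bd i).
by rewrite -!bdE (symmetric_tensorP sym).
Qed.

(** * Dehomogenization of binary forms *)

Definition dehomog (K : comNzRingType) : {mpoly K[2]} -> {poly K} :=
  mmap polyC (fun i : 'I_2 => if i == ord0 then 1 else 'X).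

HB.instance Definition _ (K : comNzRingType) :=
  GRing.RMorphism.on (@dehomog K).

Lemma dehomogZ (K : comNzRingType) (c : K) (p : {mpoly K[2]}) :
  dehomog (c *: p) = c *: dehomog p.
Proof. by rewrite /dehomog mmapZ mul_polyC. Qed.

(** In a fixed total degree the exponent of the second variable determines the monomial, so setting
    the first variable to 1 merges no terms. *)
Lemma coef_dehomog (K : comNzRingType) (d : nat) (p : {mpoly K[2]})
    (m : 'X_{1..2}) :
  p \is d.-homog -> mdeg m = d -> (dehomog p)`_(m (lift ord0 ord0)) = p@_m.
Proof.
move=> /dhomogP homp degm; rewrite /dehomog /mmap coef_sum.
have mmap1E (k : 'X_{1..2}) :
    mmap1 (fun i : 'I_2 => if i == ord0 then 1 else 'X) k
    = 'X^(k (lift ord0 ord0)) :> {poly K}.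
  by rewrite /mmap1 big_ord_recl big_ord1 expr1n mul1r.
under eq_bigr do rewrite mmap1E mul_polyC coefZ coefXn.
have eqE k : k \in msupp p ->
    (m (lift ord0 ord0) == k (lift ord0 ord0)) = (m == k).
  move=> /homp deg_k; have : mdeg k = mdeg m by rewrite degm; apply: deg_k.
  rewrite !mdegE !big_ord_recl !big_ord0 => deg_eq.
  apply/eqP/eqP => [eq1|-> //]; apply/mnmP => i.
  case: (unliftP ord0 i) => [j|] ->; first by rewrite (ord1 j).
  by move: deg_eq; rewrite eq1 => /addIn.
rewrite (eq_big_seq (fun k => if k == m then p@_m else 0)); last first.
  move=> k kp; rewrite eqE // eq_sym.
  by case: eqP => [->|_]; rewrite ?mulr1 ?mulr0.
have [mp|mp] := boolP (m \in msupp p).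
  rewrite (bigD1_seq m) ?msupp_uniq //= eqxx big1 ?addr0 // => k.
  by move/negPf->.
rewrite -big_mkcond /= big1_seq; first by apply/esym/memN_msupp_eq0.
by move=> k /andP[/eqP->]; rewrite (negPf mp).
Qed.

Lemma dehomog_inj (K : comNzRingType) (d : nat) :
  injective (fun p : dhomog 2 K d => dehomog (p : {mpoly K[2]})).
Proof.
move=> p q eq_pq; apply/val_inj/mpolyP => m.
have [degm|degm] := eqVneq (mdeg m) d.
  rewrite -(coef_dehomog (dhomog_is_dhomog p) degm) eq_pq.
  by rewrite (coef_dehomog (dhomog_is_dhomog q) degm).
rewrite (dhomog_nemf_coeff (dhomog_is_dhomog p) degm).
by rewrite (dhomog_nemf_coeff (dhomog_is_dhomog q) degm).
Qed.

Definition dehomogV (R : realType) (d : nat) (p : binform R d) : {poly R} :=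
  dehomog (p : dhomog 2 R d).

Lemma dehomogV_linear (R : realType) (d : nat) : linear (@dehomogV R d).
Proof. by move=> a p q; rewrite /dehomogV -dehomogZ -rmorphD. Qed.

HB.instance Definition _ (R : realType) (d : nat) :=
  GRing.isLinear.Build R (binform R d) {poly R} *:%R (@dehomogV R d)
    (@dehomogV_linear R d).

(** * The kernel of [mu] and the dimension of a face *)

Lemma mu_linear (R : realType) (d : nat) : linear (@mu R d).
Proof. by apply: tens_ind_linear => p a q q'; rewrite mulrDr scalerAr. Qed.

Lemma tswap_linear (K : fieldType) (V : vectType K) : linear (@tswap K V).
Proof. by apply: tens_ind_linear => p; apply: tens_linear_l. Qed.

(** Reading off the coordinates at the gap pairs, in an echelon basis of [U], is injective on
    [D]. *)
Lemma dim_symmetric_ker_mu (R : realType) (d : nat) (U : {vspace binform R d})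
    (D : {vspace tensor2 (binform R d)}) :
  (forall theta, theta \in D ->
     [/\ symmetric_tensor theta, (im_tensor theta <= U)%VS & mu theta = 0]) ->
  (\dim D <= 'C(\dim U - 1, 2))%N.
Proof.
move=> D_ker.
have phi_inj : injective (@dehomogV R d) by apply: dehomog_inj.
have [s basis_s sorted_s] := echelon_basis U phi_inj.
pose r := size s; pose b : r.-tuple (binform R d) := in_tuple s.
have -> : \dim U = r by rewrite (vector.size_basis (X := b) basis_s).
pose bd (i : 'I_r) : 'Hom(binform R d, R^o) :=
  linfun (coord b i : binform R d -> R^o).
pose M (theta : tensor2 (binform R d)) (i j : 'I_r) : R :=
  coord b j (fun_of_lfun theta (bd i)).
(* If the gap coordinates vanish, the coefficient matrix is supported on the band, where
   [band_sum_eq0] applies. *)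
have MP theta : theta \in D -> (forall i j : 'I_r, (i.+1 < j)%N -> M theta i j = 0) ->
    theta = 0.
  move=> /D_ker[sym im_U mu0] Mband.
  have im_b l : fun_of_lfun theta l \in <<b>>%VS.
    by rewrite (span_basis basis_s) (subvP im_U) // memv_img ?memvf.
  have thetaE := symmetric_tensor_coord sym im_b.
  suff M0 i j : M theta i j = 0.
    rewrite thetaE big1 // => i _; rewrite big1 // => j _.
    by rewrite -/(bd i) -/(M theta i j) M0 scale0r.
  move: i j; apply: (band_sum_eq0 (q := fun i => dehomogV b`_i)) => //.
  - move=> i; rewrite -(linear0 (@dehomogV R d)) (inj_eq phi_inj).
    by apply: (free_not0 (basis_free basis_s)); rewrite mem_nth.
  - move=> i j lt_ij; have gtn_trans : transitive gtn by move=> ? ? ? /= /[swap]; apply: ltn_trans.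
    have := sorted_ltn_nth gtn_trans 0%N sorted_s i j.
    rewrite !inE size_map !ltn_ord.
    by move=> /(_ isT isT lt_ij); rewrite !(nth_map 0) ?ltn_ord.
  - move=> i j; rewrite /M.
    have bdE k v : bd k v = coord b k v by rewrite lfunE.
    by rewrite -!bdE (symmetric_tensorP sym).
  (* The vanishing sum required is [mu theta = 0], expanded in the basis and dehomogenized. *)
  rewrite -[RHS](rmorph0 (@dehomog R)) -[in RHS]mu0 [in RHS]thetaE.
  pose mul : {linear tensor2 (binform R d) -> {mpoly R[2]}} :=
    HB.pack (@mu R d) (GRing.isLinear.Build _ _ _ _ _ (@mu_linear R d)).
  rewrite -[mu _]/(mul _) linear_sum rmorph_sum; apply: eq_bigr => i _.
  rewrite linear_sum rmorph_sum; apply: eq_bigr => j _.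
  by rewrite linearZ /= dehomogZ mu_tens rmorphM.
pose A := [set p : 'I_r * 'I_r | (p.1.+1 < p.2)%N]%SET.
pose T theta : 'rV[R]_#|A| := \row_k M theta (enum_val k).1 (enum_val k).2.
have T_lin : linear T.
  by move=> a s1 s2; apply/rowP => k; rewrite !mxE /M add_lfunE scale_lfunE linearP.
pose Tl : {linear tensor2 (binform R d) -> 'rV[R]_#|A|} :=
  HB.pack T (GRing.isLinear.Build _ _ _ _ _ T_lin).
have TE theta : linfun Tl theta = T theta by rewrite lfunE.
have dim_rV : \dim {: 'rV[R]_#|A|} = #|A|.
  by rewrite dimvf dim_matrix; apply: mul1n.
rewrite -card_gap_pairs -/A -dim_rV.
(* A linear map preserves the dimension of [D] when its kernel meets [D] trivially, which is what
   [MP] provides. *)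
rewrite -(@limg_dim_eq _ _ _ (linfun Tl)) ?dimvS ?subvf //.
apply/eqP; rewrite -subv0; apply/subvP => theta.
rewrite memv_cap memv_ker memv0 TE => /andP[Dtheta /eqP T0].
apply/eqP/(MP _ Dtheta) => i j lt_ij.
have Aij : (i, j) \in A by rewrite inE.
have /rowP/(_ (enum_rank_in Aij (i, j))) := T0.
by rewrite !mxE enum_rankK_in.
Qed.

Theorem corollary1p5 (R : realType) (d r : nat) (f : {mpoly R[2]})
    (F : set (tensor2 (binform R d))) :
  f \is (2 * d).-homog ->
  nonneg_form f ->
  F !=set0 ->
  is_face F (Gram d f) ->
  face_rank F = r ->
  (affine_dim F <= 'C(r - 1, 2))%N.
Proof.
move=> _ _ _ [FG _ _] <-.
pose swap : {linear tensor2 (binform R d) -> tensor2 (binform R d)} :=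
  HB.pack (@tswap R (binform R d))
    (GRing.isLinear.Build _ _ _ _ _ (@tswap_linear R (binform R d))).
pose mul : {linear tensor2 (binform R d) -> {mpoly R[2]}} :=
  HB.pack (@mu R d) (GRing.isLinear.Build _ _ _ _ _ (@mu_linear R d)).
(* [P] is closed under linear combinations, so [vspan_ind] reduces it to differences of two elements
   of [F], on which [mu] takes the value [f - f]. *)
pose P (theta : tensor2 (binform R d)) : Prop :=
  [/\ swap theta = theta, forall l, fun_of_lfun theta l \in face_space F &
      mul theta = 0].
apply: dim_symmetric_ker_mu => theta Dtheta.
suff [sym im_F mu0] : P theta.
  by split=> //; apply/subvP => _ /memv_imgP[l _ ->].
move: theta Dtheta; apply: vspan_ind.
- by split=> [|l|]; rewrite ?linear0 // zero_lfunE mem0v.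
- move=> a s t [symS imS muS] [symT imT muT]; split=> [|l|].
  + by rewrite linearP symS symT.
  + by rewrite add_lfunE scale_lfunE memvD ?memvZ.
  + by rewrite linearP muS muT scaler0 addr0.
have im_F theta l : F theta -> fun_of_lfun theta l \in face_space F.
  move=> Ftheta; apply: (vspanP _).1; exists theta => //=.
  by apply: memv_img; apply: memvf.
move=> _ [s Fs [t Ft <-]].
have [[symS _ muS] [symT _ muT]] := (FG _ Fs, FG _ Ft).
split=> [|l|].
- by rewrite linearB /= symS symT.
- by rewrite add_lfunE opp_lfunE memvB ?im_F.
- by rewrite linearB /= muS muT subrr.
Qed.
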